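(* For any parabolic subgroup $Q$ of $L\simeq\mathrm{GL}_n(\mathbb{R})$, the double flag variety $X=G/P_S\times L/Q$ has finitely many $L$-orbits under the diagonal action of $L$ (that is, it is of finite type).
   Context: Let $n\ge 1$, $J_n=\begin{pmatrix}0&-1_n\\1_n&0\end{pmatrix}$ and $G=\mathrm{Sp}_{2n}(\mathbb{R})=\{g\in \mathrm{GL}_{2n}(\mathbb{R})\mid {}^tgJ_ng=J_n\}$ acting on $V=\mathbb{R}^{2n}$ with standard basis $e_1,\dots,e_{2n}$. Let $V^+=\mathrm{span}_{\mathbb{R}}\{e_1,\dots,e_n\}$ and $P_S=\{g\in G\mid gV^+=V^+\}$ (the Siegel parabolic subgroup). Let $L=\left\{\begin{pmatrix}a&0\\0&{}^ta^{-1}\end{pmatrix}\,\middle|\, a\in \mathrm{GL}_n(\mathbb{R})\right\}\simeq \mathrm{GL}_n(\mathbb{R})$ be its Levi subgroup. $L$ acts on $G/P_S$ and on $L/Q$ by left multiplication. A parabolic subgroup of $\mathrm{GL}_n(\mathbb{R})$ is the stabilizer of a flag of subspaces of $\mathbb{R}^n$. *)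

(* Defs.v *)
From mathcomp Require Import all_boot all_order all_algebra.
From mathcomp Require Import classical_sets cardinality reals.

Set Implicit Arguments.
Unset Strict Implicit.
Unset Printing Implicit Defensive.

Import GRing.Theory.

Local Open Scope ring_scope.
Local Open Scope classical_set_scope.

(* Matrix groups are sets of matrices, vectors of R^n are columns, and [mximg] *)
(* is the image gU of a subspace U under g.                                   *)

Definition GLset (R : realType) (n : nat) : set 'M[R]_n :=
  [set g | g \in unitmx].

Definition mximg (R : realType) (n : nat) (g : 'M[R]_n)
    (U : {vspace 'cV[R]_n}) : {vspace 'cV[R]_n} :=
  (linfun (mulmx g) @: U)%VS.

Definition Jmx (R : realType) (n : nat) : 'M[R]_(n + n) :=
  block_mx 0 (- 1%:M) 1%:M 0.

Definition Sp (R : realType) (n : nat) : set 'M[R]_(n + n) :=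
  [set g | GLset g /\ g^T *m Jmx R n *m g = Jmx R n].

Definition Vplus (R : realType) (n : nat) : {vspace 'cV[R]_(n + n)} :=
  <<[seq delta_mx (lshift n i) ord0 | i : 'I_n]>>%VS.

Definition siegel (R : realType) (n : nat) : set 'M[R]_(n + n) :=
  [set g | Sp g /\ mximg g (Vplus R n) = Vplus R n].

Definition levi_embed (R : realType) (n : nat) (a : 'M[R]_n) : 'M[R]_(n + n) :=
  block_mx a 0 0 (invmx a^T).

Definition levi (R : realType) (n : nat) : set 'M[R]_(n + n) :=
  [set levi_embed a | a in @GLset R n].

(* The end terms 0 and R^n of a flag may be present or omitted: this does not *)
(* change the stabilizer.                                                     *)
Definition is_flag (R : realType) (n : nat) (F : seq {vspace 'cV[R]_n}) : bool :=
  sorted (fun U W => (U <= W)%VS && (U != W)) F.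

Definition flag_stabilizer (R : realType) (n : nat)
    (F : seq {vspace 'cV[R]_n}) : set 'M[R]_n :=
  [set a | GLset a /\ forall U, U \in F -> mximg a U = U].

Definition parabolicGL (R : realType) (n : nat) (P : set 'M[R]_n) : Prop :=
  exists2 F : seq {vspace 'cV[R]_n}, is_flag F & P = flag_stabilizer F.

Definition parabolic_levi (R : realType) (n : nat)
    (Q : set 'M[R]_(n + n)) : Prop :=
  exists2 P : set 'M[R]_n, parabolicGL P & Q = [set levi_embed a | a in P].

Definition translate (R : realType) (m : nat) (g : 'M[R]_m)
    (A : set 'M[R]_m) : set 'M[R]_m :=
  [set g *m a | a in A].

(* The quotient G/H, as the set of the left cosets gH with g in G. *)
Definition cosets (R : realType) (m : nat) (G H : set 'M[R]_m) :
    set (set 'M[R]_m) :=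
  [set translate g H | g in G].

Definition double_flag (R : realType) (n : nat) (Q : set 'M[R]_(n + n)) :
    set (set 'M[R]_(n + n) * set 'M[R]_(n + n)) :=
  cosets (@Sp R n) (@siegel R n) `*` cosets (@levi R n) Q.

Definition diag_act (R : realType) (m : nat) (l : 'M[R]_m)
    (x : set 'M[R]_m * set 'M[R]_m) : set 'M[R]_m * set 'M[R]_m :=
  (translate l x.1, translate l x.2).

Definition diag_orbit (R : realType) (m : nat) (L : set 'M[R]_m)
    (x : set 'M[R]_m * set 'M[R]_m) : set (set 'M[R]_m * set 'M[R]_m) :=
  [set diag_act l x | l in L].

(* Main.v *)
Require Import Defs.
From mathcomp Require Import all_boot all_order all_algebra.
From mathcomp Require Import classical_sets cardinality reals.
From mathcomp Require Import boolp ring.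

Set Implicit Arguments.
Unset Strict Implicit.
Unset Printing Implicit Defensive.

Import Order.TTheory GRing.Theory Num.Theory.

Local Open Scope ring_scope.

(** A coset of the Siegel parabolic is a Lagrangian subspace of R^n + R^n*,
    spanned by the first n columns (A; C) of a symplectic matrix.  Such a
    subspace is the same thing as a pair (U, b), where U is its projection to
    R^n and b a symmetric bilinear form on U: the intersection with R^n* is the
    annihilator of U, so the Lagrangian is determined by the map U -> U* that
    it induces, and being isotropic means that this map is symmetric.  Up to
    the action of GL_n, a point of the double flag variety is thus a triple
    (U, b, flag), and it is enough to exhibit a basis of R^n adapted to the
    flag in which U and b take one of finitely many shapes.

    Consider U first.  Taking leading indices of the vectors of U gives a basis,
    triangular with respect to any given basis adapted to the flag, that
    contains a basis of U; hence U becomes a coordinate subspace indexed by a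
    set S ([upper_reduction]).  Next reduce b, by a change of basis that is
    upper triangular and only moves the vectors indexed by S.  A symmetric
    Gaussian elimination from the smallest index of S splits off a line when
    that vector is anisotropic or in the radical, and a hyperbolic plane
    otherwise; all Gram entries end up in {-1, 0, 1}, since positive reals
    have square roots ([symm_sign_reducible]).

    So every Lagrangian is moved by upper triangular matrices to one of the
    finitely many [lag_model S N], with N a matrix of signs
    ([lagrangian_normal_form]).  In a basis h adapted to the flag, the upper
    triangular matrices stabilize the flag ([adapted_frame]), so every orbit
    meets the finite set of pairs (coset of h.(lag_model S N), Q). *)

(** * Upper triangular matrices acting on a set of coordinates *)

Section UpperTriangular.
Variables (F : fieldType) (n : nat).
Implicit Types (S T : {set 'I_n}) (c d M : 'M[F]_n).

Definition coord_proj S : 'M[F]_n := diag_mx (\row_i (i \in S)%:R).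

Lemma coord_projM_entry m S (M : 'M[F]_(n, m)) i j :
  (coord_proj S *m M) i j = (i \in S)%:R * M i j.
Proof. by rewrite mul_diag_mx !mxE. Qed.

Lemma mul_coord_proj_entry m S (M : 'M[F]_(m, n)) i j :
  (M *m coord_proj S) i j = M i j * (j \in S)%:R.
Proof. by rewrite mul_mx_diag !mxE. Qed.

Lemma tr_coord_proj S : (coord_proj S)^T = coord_proj S.
Proof. exact: tr_diag_mx. Qed.

Lemma coord_proj_idem S : coord_proj S *m coord_proj S = coord_proj S.
Proof.
apply/matrixP=> i j; rewrite coord_projM_entry !mxE.
by case: (i \in S); rewrite ?mul1r // !mul0r mul0rn.
Qed.

Lemma coord_projC S : coord_proj (~: S) = 1%:M - coord_proj S.
Proof.
apply/matrixP=> i j; rewrite !mxE !inE -mulrnBl; congr (_ *+ _).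
by case: (i \in S); rewrite ?subrr ?subr0.
Qed.

Lemma coord_proj_subl S T : S \subset T -> coord_proj T *m coord_proj S = coord_proj S.
Proof.
move=> /fintype.subsetP sST; apply/matrixP=> i j; rewrite coord_projM_entry !mxE.
by case iS: (i \in S); rewrite ?(sST _ iS) ?mul1r // mul0rn mulr0.
Qed.

Lemma coord_proj_subr S T : S \subset T -> coord_proj S *m coord_proj T = coord_proj S.
Proof.
move=> sST; rewrite -[LHS]trmxK trmx_mul !tr_coord_proj coord_proj_subl //.
exact: tr_coord_proj.
Qed.

(** Upper triangularity is expressed through the transpose because
    [is_trig_mx] means lower triangular. *)
Lemma mul_upper_triangular c d :
  is_trig_mx c^T -> is_trig_mx d^T -> is_trig_mx (c *m d)^T.
Proof.
move=> /is_trig_mxP tc /is_trig_mxP td; apply/is_trig_mxP=> i j lt_ij.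
rewrite !mxE big1 // => k _; case: (leqP j k) => [le_jk|lt_kj].
  by have := td i k (leq_trans lt_ij le_jk); rewrite mxE => ->; rewrite mulr0.
by have := tc k j lt_kj; rewrite mxE => ->; rewrite mul0r.
Qed.

(** The last two conditions say that c differs from the identity only in the
    S x S block: such base changes can be composed for varying S without
    disturbing the coordinates that are already in normal form. *)
Definition upper_on S c :=
  [/\ c \in unitmx, is_trig_mx c^T, coord_proj S *m (c - 1%:M) = c - 1%:M
    & (c - 1%:M) *m coord_proj S = c - 1%:M].

Lemma upper_on1 S : upper_on S 1%:M.
Proof. by split; rewrite ?unitmx1 ?trmx1 ?scalar_mx_is_trig ?subrr ?mulmx0 ?mul0mx. Qed.

Lemma upper_onM S c d : upper_on S c -> upper_on S d -> upper_on S (c *m d).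
Proof.
move=> [uc tc lc rc] [ud td ld rd].
have E : c *m d - 1%:M = (c - 1%:M) *m (d - 1%:M) + (c - 1%:M) + (d - 1%:M).
  rewrite -{1}[c](subrK 1%:M) -{1}[d](subrK 1%:M) mulmxDl !mulmxDr !mulmx1 !mul1mx.
  by rewrite !addrA addrK.
split; rewrite ?mul_upper_triangular ?unitmx_mul ?uc ?ud // E.
  by rewrite 2!(mulmxDr (coord_proj S)) mulmxA lc ld.
by rewrite 2!(mulmxDl _ _ (coord_proj S)) -mulmxA rc rd.
Qed.

Lemma upper_on_sub S T c : S \subset T -> upper_on S c -> upper_on T c.
Proof.
move=> sST [uc tc lc rc]; split=> //.
  by rewrite -lc mulmxA coord_proj_subl.
by rewrite -rc -mulmxA coord_proj_subr.
Qed.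

Lemma upper_on_comm S T c :
  upper_on S c -> S \subset T -> c *m coord_proj T = coord_proj T *m c.
Proof.
move=> uc sST; have [_ _ l r] := upper_on_sub sST uc.
by rewrite -[c](subrK 1%:M) mulmxDl mulmxDr l r mul1mx mulmx1.
Qed.

Lemma upper_on_fixl S c : upper_on S c ->
  coord_proj (~: S) *m c = coord_proj (~: S).
Proof.
move=> [_ _ l _]; rewrite -{1}[c](subrK 1%:M) mulmxDr mulmx1.
by rewrite {1}coord_projC mulmxBl mul1mx l subrr add0r.
Qed.

Lemma upper_unit c : is_trig_mx c^T -> (forall i, c i i != 0) -> c \in unitmx.
Proof.
move=> tc nz; rewrite -unitmx_tr unitmxE det_trig // unitfE prodf_seq_neq0.
by apply/allP=> i _; rewrite mxE nz.
Qed.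

(** Bruhat decomposition for the column space U of A: call the largest index of
    a nonzero coordinate of a vector its leading index, and let S be the set of
    leading indices of U.  Choosing for each i in S a vector of U with leading
    coordinate 1 at i, and the basis vector e_i for i outside S, gives the
    columns of a unitriangular V.  The chosen vectors of U span U by induction
    on the leading index, so A and V *m coord_proj S have the same column
    space. *)
Lemma upper_reduction (A : 'M[F]_n) : exists S V r,
  [/\ V \in unitmx, is_trig_mx V^T, r \in unitmx & A = V *m coord_proj S *m r].
Proof.
pose vanish (x : 'cV[F]_n) (m : nat) := forall j : 'I_n, (m <= j)%N -> x j 0 = 0.
have : forall i : 'I_n, exists p : bool * 'cV[F]_n,
    if p.1 then (A *m p.2) i 0 = 1 /\ vanish (A *m p.2) i.+1
    else forall x, vanish (A *m x) i.+1 -> (A *m x) i 0 = 0.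
  move=> i.
  have [[x xP]|noP] := EM (exists x, (A *m x) i 0 = 1 /\ vanish (A *m x) i.+1).
    by exists (true, x).
  exists (false, 0) => /= x vx; apply/eqP; apply: contrapT => /negP nz; apply: noP.
  exists (((A *m x) i 0)^-1 *: x); rewrite -scalemxAr.
  split; first by rewrite mxE mulVf.
  by move=> j lt_ij; rewrite mxE (vx j lt_ij) mulr0.
(* (p i).1 tells whether i is a leading index; then A *m (p i).2 is a witness. *)
case/fin_all_exists=> p pP; pose S := [set i | (p i).1].
pose y i : 'cV[F]_n := if i \in S then A *m (p i).2 else delta_mx i 0.
pose V := \matrix_(i, j) y j i 0; pose X := \matrix_(i, j) ((j \in S)%:R * (p j).2 i 0).
have yii i : y i i 0 = 1.
  by rewrite /y inE; move: (pP i); case: (p i).1 => [[]//|_]; rewrite mxE !eqxx.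
have yv i : vanish (y i) i.+1.
  rewrite /y inE; move: (pP i); case: (p i).1 => [[]//|_] j lt_ij.
  by rewrite mxE; case: eqP lt_ij => // ->; rewrite ltnn.
have tV : is_trig_mx V^T by apply/is_trig_mxP=> i j lt_ij; rewrite !mxE yv.
have uV : V \in unitmx.
  by apply: upper_unit => // i; rewrite mxE yii oner_eq0.
have colVS i : i \in S -> V *m coord_proj S *m delta_mx i 0 = y i.
  move=> iS; rewrite -colE; apply/colP=> k.
  by rewrite mxE mul_coord_proj_entry iS mulr1 mxE.
have VX : V *m coord_proj S = A *m X.
  apply/matrixP=> i j; rewrite mul_coord_proj_entry !mxE.
  under eq_bigr do rewrite mxE.
  case jS: (j \in S).
    by rewrite /y jS mulr1 mxE; apply: eq_bigr => k _; rewrite mul1r.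
  by rewrite mulr0 big1 // => k _; rewrite mul0r mulr0.
have lead m x : vanish (A *m x) m -> exists z, A *m x = V *m coord_proj S *m z.
  elim: m x => [|m IH] x vx.
    by exists 0; rewrite mulmx0; apply/colP=> j; rewrite vx // mxE.
  have [le_nm|lt_mn] := leqP n m.
    by apply: IH => j le_mj; have := leq_trans le_nm le_mj; rewrite leqNgt ltn_ord.
  pose i := Ordinal lt_mn; case iS: (i \in S).
    pose a := (A *m x) i 0; have [|z zP] := IH (x - a *: (p i).2).
      move=> j; rewrite leq_eqVlt => /predU1P [jm|lt_mj].
        have -> : j = i by apply: val_inj.
        rewrite mulmxBr -scalemxAr; have := yii i; rewrite /y iS => yi.
        by rewrite -/a [LHS]mxE [X in _ + X]mxE [X in _ - X]mxE yi mulr1 subrr.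
      rewrite mulmxBr -scalemxAr; have := yv i j lt_mj; rewrite /y iS => yi.
      by rewrite [LHS]mxE [X in _ + X]mxE [X in _ - X]mxE yi mulr0 subr0 vx.
    exists (z + a *: delta_mx i 0); rewrite mulmxDr -zP -scalemxAr colVS // /y iS.
    by rewrite mulmxBr -scalemxAr subrK.
  apply: IH => j; rewrite leq_eqVlt => /predU1P [jm|lt_mj]; last exact: vx.
  have -> : j = i by apply: val_inj.
  by have := pP i; move: iS; rewrite inE => -> /(_ x vx).
have /eqmxMunitP [r ur Ar] : (A^T == (V *m coord_proj S)^T)%MS.
  apply/andP; split; last by rewrite VX trmx_mul submxMl.
  apply/row_subP=> i; have [|z zP] := lead n (delta_mx i 0).
    by move=> j; rewrite leqNgt ltn_ord.
  by rewrite -tr_col colE zP trmx_mul submxMl.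
exists S, V, r^T; split=> //; first by rewrite unitmx_tr.
by rewrite -[LHS]trmxK Ar trmx_mul trmxK.
Qed.

(** * Symmetric forms under triangular congruence *)

(** By symmetry the one-sided condition forces M to vanish off the S x S
    block. *)
Definition symm_on S M := M^T = M /\ coord_proj S *m M = M.

Lemma symm_on_cong S c M : upper_on S c -> symm_on S M -> symm_on S (c^T *m M *m c).
Proof.
move=> uc [sM pM]; split; first by rewrite !trmx_mul trmxK sM mulmxA.
rewrite !mulmxA; congr (_ *m c).
rewrite -[coord_proj _]tr_coord_proj -trmx_mul (upper_on_comm uc) // trmx_mul.
by rewrite tr_coord_proj -mulmxA pM.
Qed.

Lemma symm_on_out S M i j : symm_on S M -> (i \notin S) || (j \notin S) -> M i j = 0.
Proof.
move=> [sM pM]; wlog iS : i j / i \notin S => [wl|_].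
  by case/orP=> [iS|jS]; [apply: wl; rewrite ?iS | rewrite -sM mxE wl // jS].
by rewrite -pM coord_projM_entry (negPf iS) mul0r.
Qed.

(** The elementary step of the elimination: the vector i is added, with
    coefficients w, to the vectors of index at least i, and is itself scaled
    by 1 + w_i. *)
Lemma upper_on_row S (i : 'I_n) (w : 'rV[F]_n) :
  i \in S -> (forall j, w 0 j != 0 -> (j \in S) && (i <= j)%N) -> 1 + w 0 i != 0 ->
  upper_on S (1%:M + delta_mx i 0 *m w).
Proof.
move=> iS ws wi.
have E k j : (delta_mx i 0 *m w : 'M[F]_n) k j = (k == i)%:R * w 0 j.
  by rewrite mxE big_ord1 !mxE eqxx andbT.
have w0 j : ~~ ((j \in S) && (i <= j)%N) -> w 0 j = 0.
  by move=> h; apply/eqP; apply: contraNT h; apply: ws.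
have tE : is_trig_mx (1%:M + delta_mx i 0 *m w)^T.
  apply/is_trig_mxP=> k j lt_kj; rewrite mxE mxE E mxE.
  rewrite (_ : (j == k) = false) ?add0r; last first.
    by apply/eqP=> jk; rewrite jk ltnn in lt_kj.
  case: eqP => [ji|]; last by rewrite mul0r.
  by rewrite w0 ?mulr0 // negb_and -ltnNge -ji lt_kj orbT.
split=> //; first apply: upper_unit => // j.
- rewrite mxE E mxE eqxx; have [->|_] := eqVneq j i; first by rewrite mul1r.
  by rewrite mul0r addr0 oner_eq0.
- rewrite addrC addKr; apply/matrixP=> k j; rewrite coord_projM_entry E.
  by have [->|_] := eqVneq k i; rewrite ?iS ?mul1r // mul0r mulr0.
- rewrite addrC addKr; apply/matrixP=> k j; rewrite mul_coord_proj_entry E.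
  by case jS: (j \in S); rewrite ?mulr1 // w0 ?jS // !mulr0.
Qed.

Lemma cong_row_entry (i : 'I_n) (w : 'rV[F]_n) M j l :
  ((1%:M + delta_mx i 0 *m w)^T *m M *m (1%:M + delta_mx i 0 *m w)) j l =
  M j l + w 0 j * M i l + M j i * w 0 l + w 0 j * M i i * w 0 l.
Proof.
rewrite [(_ + _)^T]linearD /= trmx1 trmx_mul trmx_delta.
rewrite mulmxDl mul1mx mulmxDr mulmx1 mulmxDl.
rewrite -[w^T *m _ *m M]mulmxA -rowE [M *m (_ *m w)]mulmxA -colE.
rewrite -[w^T *m _ *m _]mulmxA [row i M *m _]mulmxA -colE.
by rewrite !mxE !big_ord1 !mxE !big_ord1 !mxE !addrA mulrA.
Qed.

End UpperTriangular.

Section SignReduction.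
Variables (R : rcfType) (n : nat).
Implicit Types (S T : {set 'I_n}) (c d M : 'M[R]_n).

Definition sign_mx M := forall i j, M i j \in [:: -1; 0; 1].

Definition sign_reducible S M :=
  exists2 c, upper_on S c & sign_mx (c^T *m M *m c).

Lemma sign_reducible_cong S c M :
  upper_on S c -> sign_reducible S (c^T *m M *m c) -> sign_reducible S M.
Proof.
move=> uc [d ud sd]; exists (c *m d); first exact: upper_onM.
by rewrite trmx_mul !mulmxA in sd *.
Qed.

(** If the coordinates in T are orthogonal to the others and their Gram matrix
    is already made of signs, then only the block S minus T remains, and base
    changes supported on that block do not alter the T x T block. *)
Lemma sign_reducible_split S T M : symm_on S M ->
    (forall i j, i \in T -> j \notin T -> M i j = 0) ->
    (forall i j, i \in T -> j \in T -> M i j \in [:: -1; 0; 1]) ->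
    (forall N, symm_on (S :\: T) N -> sign_reducible (S :\: T) N) ->
  sign_reducible S M.
Proof.
move=> hM offT onT IH; have [sM pM] := hM.
pose P := coord_proj R (S :\: T); pose P' := coord_proj R T.
pose N := P *m M *m P.
have hN : symm_on (S :\: T) N.
  split; first by rewrite !trmx_mul tr_coord_proj sM mulmxA.
  by rewrite !mulmxA coord_proj_idem.
have [c uc sc] := IH N hN.
exists c; first by apply: upper_on_sub uc; exact: finset.subsetDl.
have ME : M = P' *m M *m P' + N.
  apply/matrixP=> i j.
  rewrite mxE !mul_coord_proj_entry !coord_projM_entry !inE.
  case iT: (i \in T); case jT: (j \in T);
    rewrite /= ?mul0r ?mul1r ?mulr0 ?mulr1 ?addr0 ?add0r //.
  - by rewrite offT ?jT.
  - by rewrite -sM mxE offT ?iT.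
  case iS: (i \in S); last by rewrite (symm_on_out hM) ?iS // !mulr0 mul0r.
  case jS: (j \in S); last by rewrite (symm_on_out hM) ?jS ?orbT // !mulr0.
  by rewrite mul1r mulr1.
have P'c : P' *m c = P'.
  have sT : T \subset ~: (S :\: T).
    by apply/fintype.subsetP=> i iT; rewrite !inE iT.
  rewrite /P' -(coord_proj_subr R sT) -[LHS]mulmxA upper_on_fixl //.
have -> : c^T *m M *m c = P' *m M *m P' + c^T *m N *m c.
  rewrite {1}ME mulmxDr mulmxDl; congr (_ + _).
  rewrite -!mulmxA P'c !mulmxA; congr (_ *m _ *m _).
  by rewrite /P' -[in LHS](tr_coord_proj R T) -trmx_mul P'c tr_coord_proj.
have hN' := symm_on_cong uc hN.
move=> i j; rewrite mxE mul_coord_proj_entry coord_projM_entry.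
case iT: (i \in T); last by rewrite !mul0r add0r.
rewrite (symm_on_out hN') ?finset.in_setD ?iT // addr0 mul1r.
case jT: (j \in T); first by rewrite mulr1 onT.
by rewrite mulr0 !inE eqxx orbT.
Qed.

Lemma sign_reducible_split1 S i M : symm_on S M -> i \in S ->
    (forall j, j != i -> M i j = 0) -> M i i \in [:: -1; 0; 1] ->
    (forall S' N, #|S'| < #|S| -> symm_on S' N -> sign_reducible S' N)%N ->
  sign_reducible S M.
Proof.
move=> hM iS off di IH; apply: (@sign_reducible_split S [set i]) => //.
- by move=> k j; rewrite !inE => /eqP-> /off.
- by move=> k j /set1P-> /set1P->.
- by move=> N; apply: IH; rewrite [in ltnRHS](cardsD1 i) iS.
Qed.

(** The vectors i and k pair to 1 and i is isotropic and orthogonal to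
    everything but k.  Adding multiples of the vector i, which is allowed
    because i is the smallest index, makes k isotropic and orthogonal to the
    rest; then i and k span a hyperbolic plane that splits off. *)
Lemma sign_reducible_isotropic S i k M : symm_on S M -> i \in S -> k \in S ->
    (forall j, j \in S -> (i <= j)%N) -> k != i ->
    (forall j, M i j = (j == k)%:R) ->
    (forall S' N, #|S'| < #|S| -> symm_on S' N -> sign_reducible S' N)%N ->
  sign_reducible S M.
Proof.
move=> hM iS kS mini ki Mi IH; have [sM _] := hM.
have Mji j : M j i = (j == k)%:R by rewrite -sM mxE Mi.
have ik : (i == k) = false by rewrite eq_sym (negPf ki).
(* The half accounts for the two equal cross terms that correct M k k. *)
pose w : 'rV[R]_n := \row_j
  (if j == i then 0 else if j == k then - M k k / 2 else - M k j).
have wi : w 0 i = 0 by rewrite mxE eqxx.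
have uc : upper_on S (1%:M + delta_mx i 0 *m w).
  apply: upper_on_row => //; last by rewrite wi addr0 oner_eq0.
  move=> j; rewrite mxE; case: (j =P i) => _; first by rewrite eqxx.
  case: (j =P k) => [-> _|_]; first by rewrite kS mini.
  case jS: (j \in S); first by rewrite mini.
  by rewrite (symm_on_out hM) ?jS ?orbT // oppr0 eqxx.
apply: (sign_reducible_cong uc); have := symm_on_cong uc hM.
set N := _ *m _ *m _ => hN.
have NE j l : N j l = M j l + w 0 j * (l == k)%:R + (j == k)%:R * w 0 l.
  by rewrite cong_row_entry !Mi Mji ik mulr0 mul0r addr0.
have Ni l : N i l = (l == k)%:R by rewrite NE wi Mi ik !mul0r !addr0.
have Nk l : N k l = (l == i)%:R.
  rewrite NE eqxx mul1r; have [->|li] := eqVneq l i.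
    by rewrite wi ik mulr0 !addr0 Mji eqxx.
  rewrite !mxE eqxx (negPf ki) (negPf li); case: eqVneq => [->|_].
    by rewrite mulr1 mulr0n; field.
  by rewrite mulr0 addr0 subrr.
apply: (@sign_reducible_split S [set i; k]) => //.
- by move=> j l; rewrite !inE negb_or => /orP[] /eqP-> /andP[/negPf li /negPf lk];
    rewrite ?Ni ?Nk ?li ?lk.
- by move=> j l /set2P[]-> _; rewrite ?Ni ?Nk; case: (l == _); rewrite !inE eqxx ?orbT.
- move=> L; apply: IH; apply: proper_card; apply/properP.
  split; first exact: finset.subsetDl.
  by exists i; rewrite // !inE eqxx.
Qed.

(** The Borel subgroup has finitely many orbits on symmetric matrices.  Let i be
    the smallest index of S.  If M i i <> 0, scale it to a sign and clear its
    row; if the row of i vanishes, there is nothing to do; otherwise let k be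
    the first index with M i k <> 0.  As k is the first one, the rest of the
    row of i can be cleared by adding the vector k to later vectors only, which
    leads to the situation of [sign_reducible_isotropic]. *)
Lemma symm_sign_reducible S M : symm_on S M -> sign_reducible S M.
Proof.
have [m] := ubnP #|S|; elim: m => // m IHm in S M * => /ltnSE le_Sm hM.
have IH (S' : {set 'I_n}) N :
    (#|S'| < #|S|)%N -> symm_on S' N -> sign_reducible S' N.
  by move=> lt_S; apply: IHm; apply: leq_trans lt_S le_Sm.
have [S0|[i0 i0S]] := set_0Vmem S.
  exists 1%:M => [|i j]; first exact: upper_on1.
  by rewrite trmx1 mul1mx mulmx1 (symm_on_out hM) ?S0 ?inE ?eqxx ?orbT.
have [i] := arg_minnP (fun i : 'I_n => val i) i0S.
rewrite -/(i \in S) => iS mini.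
have Mout j : M i j != 0 -> j \in S.
  by apply: contraNT => jS; rewrite (symm_on_out hM) ?jS ?orbT.
have [Mii|Mii] := eqVneq (M i i) 0; last first.
  (* Scaling by 1 / sqrt |M i i| turns M i i into its sign. *)
  pose w : 'rV[R]_n := \row_j
    (if j == i then (Num.sqrt `|M i i|)^-1 - 1 else - M i j / M i i).
  have sq0 : Num.sqrt `|M i i| != 0 by rewrite sqrtr_eq0 -ltNge normr_gt0.
  have wi : 1 + w 0 i = (Num.sqrt `|M i i|)^-1 by rewrite mxE eqxx addrC subrK.
  have uc : upper_on S (1%:M + delta_mx i 0 *m w).
    apply: upper_on_row => //; last by rewrite wi invr_eq0.
    move=> j; rewrite mxE; case: (j =P i) => [-> _|_ nz]; first by rewrite iS leqnn.
    have jS : j \in S by apply: Mout; apply: contraNneq nz => ->; rewrite oppr0 mul0r.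
    by rewrite jS mini.
  apply: (sign_reducible_cong uc); have hN := symm_on_cong uc hM.
  apply: (sign_reducible_split1 hN iS) => // [j ji|]; rewrite cong_row_entry.
    have -> : M i j + w 0 i * M i j + M i i * w 0 j + w 0 i * M i i * w 0 j =
      (1 + w 0 i) * (M i j + M i i * w 0 j) by ring.
    by rewrite [w 0 j]mxE (negPf ji) mulrC [M i i * _]mulrC divfK // addrN mul0r.
  have -> : M i i + w 0 i * M i i + M i i * w 0 i + w 0 i * M i i * w 0 i =
    M i i * (1 + w 0 i) ^+ 2 by ring.
  rewrite wi exprVn sqr_sqrtr // !inE.
  have [lt0|gt0|M0] := ltgtP (M i i) 0; last by rewrite M0 eqxx in Mii.
    by rewrite ltr0_norm // invrN mulrN divff // eqxx.
  by rewrite gtr0_norm // divff // eqxx !orbT.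
have [/existsP[k0 k0P]|/existsPn M0] := boolP [exists j, M i j != 0]; last first.
  apply: (sign_reducible_split1 hM iS) => // [j _|]; last by rewrite Mii !inE eqxx orbT.
  by apply/eqP; rewrite -[_ == _]negbK M0.
have [k /= kP mink] :=
  @arg_minnP _ k0 (fun j => M i j != 0) (fun j : 'I_n => val j) k0P.
pose w : 'rV[R]_n := \row_j
    (if j == k then (M i k)^-1 - 1 else - M i j / M i k).
have ki : k != i by apply: contraNneq kP => ->; rewrite Mii.
have wk : 1 + w 0 k = (M i k)^-1 by rewrite mxE eqxx addrC subrK.
have wi : w 0 i = 0 by rewrite mxE eq_sym (negPf ki) Mii oppr0 mul0r.
have kS := Mout k kP.
have uc : upper_on S (1%:M + delta_mx k 0 *m w).
  apply: upper_on_row => //; last by rewrite wk invr_eq0.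
  move=> j; rewrite mxE; case: (j =P k) => [-> _|_ nz]; first by rewrite kS leqnn.
  have Mij : M i j != 0 by apply: contraNneq nz => ->; rewrite oppr0 mul0r.
  by rewrite Mout // mink.
apply: (sign_reducible_cong uc); have hN := symm_on_cong uc hM.
apply: (sign_reducible_isotropic hN iS kS _ ki) => // j.
rewrite cong_row_entry wi !mul0r !addr0.
have [->|jk] := eqVneq j k.
  by rewrite -{1}[M i k]mulr1 -mulrDr wk divff.
by rewrite mxE (negPf jk) mulrC divfK // addrN.
Qed.
End SignReduction.

(** * Lagrangian subspaces up to the Levi subgroup *)

Local Open Scope classical_set_scope.

Section Lagrangian.
Variables (R : realType) (n : nat).
Implicit Types (a c p r A C : 'M[R]_n) (g h : 'M[R]_(n + n)).

Lemma levi_embedM a c : a \in unitmx -> c \in unitmx ->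
  levi_embed (a *m c) = levi_embed a *m levi_embed c.
Proof.
move=> ua uc; rewrite /levi_embed mulmx_block !mulmx0 !mul0mx !addr0 add0r.
congr block_mx; rewrite trmx_mul.
have uac : c^T *m a^T \in unitmx by rewrite unitmx_mul !unitmx_tr uc.
apply: (can_inj (mulKmx uac)); rewrite mulmxV //.
by rewrite -mulmxA mulKVmx ?unitmx_tr // mulmxV // unitmx_tr.
Qed.

Lemma levi_embed1 : levi_embed (1%:M : 'M[R]_n) = 1%:M.
Proof. by rewrite /levi_embed trmx1 invmx1 -scalar_mx_block. Qed.

Lemma levi_embed_col a m (M N : 'M[R]_(n, m)) :
  levi_embed a *m col_mx M N = col_mx (a *m M) (invmx a^T *m N).
Proof. by rewrite mul_block_col !mul0mx addr0 add0r. Qed.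

Lemma levi_embed_unit a : a \in unitmx -> levi_embed a \in unitmx.
Proof.
move=> ua; have ua' : invmx a \in unitmx by rewrite unitmx_inv.
have [] // := @mulmx1_unit _ _ (levi_embed a) (levi_embed (invmx a)).
by rewrite -levi_embedM // mulmxV // levi_embed1.
Qed.

Lemma levi_embed_Sp a : a \in unitmx -> Sp (levi_embed a).
Proof.
move=> ua; split; first exact: levi_embed_unit.
rewrite /Jmx /levi_embed tr_block_mx !trmx0 !mulmx_block.
rewrite !mulmx0 !mul0mx !addr0 !add0r !mulmx1 trmx_inv trmxK.
by rewrite !mul0mx mulmxN mulmx1 mulNmx mulVmx // mulmxV ?unitmx_tr.
Qed.

Lemma SpM g h : Sp g -> Sp h -> Sp (g *m h).
Proof.
move=> [ug gJ] [uh hJ]; split; first by rewrite /GLset /= unitmx_mul ug.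
rewrite trmx_mul -!mulmxA (mulmxA _ g) (mulmxA _ _ h) (mulmxA _ (Jmx R n)).
by rewrite gJ mulmxA hJ.
Qed.

Lemma SpV g : Sp g -> Sp (invmx g).
Proof.
move=> [ug gJ]; split; first by rewrite /GLset /= unitmx_inv.
rewrite -gJ trmx_inv !mulmxA mulVmx ?unitmx_tr // mul1mx -mulmxA mulmxV //.
by rewrite mulmx1.
Qed.

(** When N is symmetric and supported on S x S, the columns of this matrix span
    the Lagrangian attached to the coordinate subspace U indexed by S and the
    form N on U; the block [coord_proj (~: S)] spans the annihilator of U. *)
Definition lag_model (S : {set 'I_n}) N : 'M[R]_(n + n, n) :=
  col_mx (coord_proj R S) (coord_proj R (~: S) + N).

(** The columns of (A; C) form a basis of a Lagrangian subspace, isotropic by the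
    first hypothesis and n-dimensional since K is a left inverse.  A triangular
    base change V makes its projection a coordinate subspace, a change r2 of the
    basis of the Lagrangian clears C outside the S x S block and the annihilator,
    and a second triangular base change c reduces the form in that block. *)
Lemma lagrangian_normal_form A C (K : 'M[R]_(n, n + n)) :
    A^T *m C = C^T *m A -> K *m col_mx A C = 1%:M ->
  exists S N p r, [/\ p \in unitmx, is_trig_mx p^T, r \in unitmx, sign_mx N
    & col_mx A C = levi_embed p *m lag_model S N *m r].
Proof.
move=> symAC KAC; have [S [V [r1 [uV tV ur1 AE]]]] := upper_reduction A.
set D := coord_proj R S in AE; set D' := coord_proj R (~: S).
have DE : D *m D = D by apply: coord_proj_idem.
have tD : D^T = D by apply: tr_coord_proj.
have DD' : D *m D' = 0 by rewrite /D' coord_projC mulmxBr mulmx1 DE subrr.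
have D'D : D' *m D = 0 by rewrite /D' coord_projC mulmxBl mul1mx DE subrr.
have D'E : D' = 1%:M - D by apply: coord_projC.
have D'D' : D' *m D' = D' by apply: coord_proj_idem.
have [C1 CE] : exists C1, C = invmx V^T *m C1 *m r1.
  exists (V^T *m C *m invmx r1).
  by rewrite -!mulmxA mulVmx // mulmx1 mulKmx // unitmx_tr.
(* Isotropy is preserved: the form D *m C1 on the coordinate subspace is
   symmetric. *)
have sDC : D *m C1 = C1^T *m D.
  have : r1^T *m (D *m C1) *m r1 = r1^T *m (C1^T *m D) *m r1.
    have -> : r1^T *m (D *m C1) *m r1 = A^T *m C.
      by rewrite AE CE !trmx_mul tD !mulmxA mulmxK // unitmx_tr.
    by rewrite symAC AE {1}CE !trmx_mul trmx_inv trmxK !mulmxA mulmxKV.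
  have ur1T : r1^T \in unitmx by rewrite unitmx_tr.
  by move/(can_inj (mulmxK ur1))/(can_inj (mulKmx ur1T)).
have DCD : D *m C1 *m D = D *m C1 by rewrite {1}sDC -mulmxA DE.
(* r2 relates two bases of the same Lagrangian: D *m C1 *m D' = 0 says that the
   columns of C1 outside S already lie in the annihilator of U. *)
pose r2 := D + D' *m C1.
have r2E : col_mx D C1 = col_mx D (D' + D *m C1) *m r2.
  rewrite mul_col_mx /r2; congr col_mx.
    by rewrite mulmxDr DE mulmxA DD' mul0mx addr0.
  rewrite mulmxDl !mulmxDr D'D add0r (mulmxA D' D') D'D' DCD.
  rewrite (mulmxA _ D') {2}D'E mulmxBr mulmx1 DCD subrr mul0mx addr0.
  by rewrite D'E mulmxBl mul1mx subrK.
have L1 : col_mx A C = levi_embed V *m col_mx D (D' + D *m C1) *m (r2 *m r1).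
  by rewrite mulmxA -(mulmxA (levi_embed V)) -r2E levi_embed_col mul_col_mx -AE -CE.
have ur2 : r2 \in unitmx.
  have : (r1 *m K *m (levi_embed V *m col_mx D (D' + D *m C1))) *m r2 = 1%:M.
    apply: (can_inj (mulmxK ur1)).
    by rewrite -!mulmxA (mulmxA (levi_embed V)) -L1 KAC mulmx1 mul1mx.
  by case/mulmx1_unit.
(* As c is the identity outside S, it fixes D' and commutes with D. *)
have [|c uc sc] := @symm_sign_reducible R n S (D *m C1).
  split; last by rewrite mulmxA DE.
  by rewrite trmx_mul tD sDC.
have [uc1 tc _ _] := uc.
have cD : c *m D = D *m c by apply: upper_on_comm uc _.
have D'c : D' *m c = D' by apply: upper_on_fixl uc.
have tcD' : c^T *m D' = D'.
  by rewrite -[D'](tr_coord_proj R (~: S)) -trmx_mul D'c.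
exists S, (c^T *m (D *m C1) *m c), (V *m c), (invmx c *m (r2 *m r1)); split => //.
- by rewrite unitmx_mul uV.
- exact: mul_upper_triangular.
- by rewrite !unitmx_mul unitmx_inv uc1 ur2.
rewrite L1 levi_embedM // !mulmxA; congr (_ *m _ *m _).
rewrite -!mulmxA; congr (_ *m _).
rewrite mulmxA levi_embed_col mul_col_mx; congr col_mx.
  by rewrite cD mulmxK.
rewrite -/D'; have -> : D' + c^T *m (D *m (C1 *m c)) = c^T *m (D' + D *m C1) *m c.
  by rewrite mulmxDr mulmxDl tcD' D'c !mulmxA.
by rewrite !mulmxA mulVmx ?unitmx_tr // mul1mx mulmxK.
Qed.
End Lagrangian.

(** * Cosets of the Siegel parabolic *)

Section Cosets.
Variables (R : realType) (n : nat).
Implicit Types (a c p r A C : 'M[R]_n) (g h l : 'M[R]_(n + n)) (N : 'M[R]_(n + n, n)).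

Lemma Sp_lagrangian g : Sp g ->
  (ulsubmx g)^T *m dlsubmx g = (dlsubmx g)^T *m ulsubmx g.
Proof.
move=> [_]; rewrite -{1 2}[g]submxK /Jmx tr_block_mx !mulmx_block.
case/eq_block_mx=> + _ _ _.
rewrite !mulmx0 !mulmx1 add0r addr0 mulmxN mulmx1 mulNmx.
by move/eqP; rewrite addr_eq0 opprK => /eqP ->.
Qed.

Lemma translateM m (g h : 'M[R]_m) (X : set 'M[R]_m) :
  translate (g *m h) X = translate g (translate h X).
Proof.
apply/seteqP; split=> x /=.
  by case=> y Xy <-; exists (h *m y); rewrite ?mulmxA //; exists y.
by case=> _ [y Xy <-] <-; exists y; rewrite ?mulmxA.
Qed.

Lemma translate_stable m (g : 'M[R]_m) (X : set 'M[R]_m) : g \in unitmx ->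
    (forall x, X x -> X (g *m x)) -> (forall x, X x -> X (invmx g *m x)) ->
  translate g X = X.
Proof.
move=> ug Xg XVg; apply/seteqP; split=> x /= => [[y Xy <-]|Xx]; first exact: Xg.
by exists (invmx g *m x); [exact: XVg | rewrite mulKVmx].
Qed.

(** The symplectic matrices that map the standard Lagrangian onto the column
    space of N.  This description of the cosets of the Siegel parabolic makes
    sense without completing N to a symplectic matrix. *)
Definition lag_coset N : set 'M[R]_(n + n) :=
  [set g | Sp g /\ exists2 r, r \in unitmx & lsubmx g = N *m r].

Lemma lag_cosetMr N r : r \in unitmx -> lag_coset (N *m r) = lag_coset N.
Proof.
move=> ur; apply/seteqP; split=> g /= [Sg [s us gE]]; split=> //.
  by exists (r *m s); rewrite ?unitmx_mul ?ur // mulmxA.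
by exists (invmx r *m s); rewrite ?unitmx_mul ?unitmx_inv ?ur // mulmxA mulmxK.
Qed.

Lemma translate_lag_coset l N : Sp l ->
  translate l (lag_coset N) = lag_coset (l *m N).
Proof.
move=> Sl; have ul : l \in unitmx by case: Sl.
apply/seteqP; split=> x /=.
  case=> g [Sg [r ur gE]] <-; split; first exact: SpM.
  by exists r; rewrite // -mulmx_lsub gE mulmxA.
move=> [Sx [r ur xE]]; exists (invmx l *m x); last by rewrite mulKVmx.
split; first by apply: SpM => //; apply: SpV.
by exists r; rewrite // -mulmx_lsub xE -mulmxA mulKmx.
Qed.

Lemma mem_Vplus (v : 'cV[R]_(n + n)) : (v \in Vplus R n) = (dsubmx v == 0).
Proof.
apply/idP/eqP => [|v0].
  pose dsub := linfun (dsubmx : 'cV[R]_(n + n) -> 'cV[R]_n).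
  suff /subvP sub : (Vplus R n <= lker dsub)%VS.
    by move/sub; rewrite memv_ker lfunE => /eqP.
  apply/span_subvP=> w /mapP[i _ ->]; rewrite memv_ker lfunE.
  by apply/eqP/colP=> j; rewrite !mxE eq_rlshift.
suff -> : v = \sum_i v (lshift n i) 0 *: delta_mx (lshift n i) 0.
  apply: rpred_sum => i _; apply: rpredZ; apply: memv_span.
  by apply: map_f; rewrite mem_enum.
rewrite [LHS]matrix_sum_delta big_split_ord /= [X in _ + X]big1 ?addr0.
  by apply: eq_bigr => i _; rewrite big_ord1.
move=> i _; rewrite big_ord1; have /colP/(_ i) := v0.
by rewrite !mxE => ->; rewrite scale0r.
Qed.

Lemma mximgP m (g : 'M[R]_m) (U : {vspace 'cV[R]_m}) (v : 'cV[R]_m) :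
  reflect (exists2 u, u \in U & v = g *m u) (v \in mximg g U).
Proof.
by apply: (iffP memv_imgP) => -[u uU ->]; exists u => //; rewrite lfunE.
Qed.

Lemma mximgM m (g h : 'M[R]_m) (U : {vspace 'cV[R]_m}) :
  mximg (g *m h) U = mximg g (mximg h U).
Proof.
apply/vspaceP=> v; apply/mximgP/mximgP.
  by case=> u uU ->; exists (h *m u); rewrite ?mulmxA //; apply/mximgP; exists u.
by case=> _ /mximgP[u uU ->] ->; exists u; rewrite ?mulmxA.
Qed.

Lemma mximg1 m (U : {vspace 'cV[R]_m}) : mximg 1%:M U = U.
Proof.
apply/vspaceP=> v; apply/mximgP/idP => [[u uU ->]|vU]; first by rewrite mul1mx.
by exists v; rewrite ?mul1mx.
Qed.

Lemma mximg_stable m (g : 'M[R]_m) (U : {vspace 'cV[R]_m}) :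
  g \in unitmx -> (forall u, u \in U -> g *m u \in U) -> mximg g U = U.
Proof.
move=> ug gU; apply/eqP; rewrite eqEdim; apply/andP; split.
  by apply/subvP=> v /mximgP[u uU ->]; exact: gU.
rewrite limg_dim_eq //; apply/eqP; rewrite -subv0; apply/subvP=> v.
rewrite memv_cap memv_ker lfunE memv0 => /andP[_ /eqP gv0].
by rewrite -[v](mulKmx ug) gv0 mulmx0.
Qed.

(** A symplectic matrix stabilizes the standard Lagrangian exactly when its
    lower left block vanishes; its upper left block is then invertible by block
    triangularity. *)
Lemma siegelE : @siegel R n = lag_coset (lsubmx 1%:M).
Proof.
apply/seteqP; split=> g /= [Sg gP]; split=> //; last first.
  have [r ur gE] := gP; have [ug _] := Sg.
  apply: mximg_stable => // u; rewrite !mem_Vplus => /eqP u0.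
  rewrite -[u]vsubmxK u0 -[g]hsubmxK gE mul_row_col mulmx0 addr0.
  rewrite (scalar_mx_block n n 1) block_mxEh row_mxKl.
  by rewrite mul_col_mx mul0mx mul_col_mx col_mxKd mul0mx.
have [ug _] := Sg.
have dl0 : dlsubmx g = 0.
  apply/matrixP=> i j; have : g *m delta_mx (lshift n j) 0 \in Vplus R n.
    rewrite -{1}gP; apply/mximgP; exists (delta_mx (lshift n j) 0) => //.
    by apply: memv_span; apply: map_f; rewrite mem_enum.
  by rewrite mem_Vplus -colE => /eqP/colP/(_ i); rewrite !mxE.
exists (ulsubmx g).
  move: ug; rewrite /GLset /= unitmxE -[g]submxK dl0 det_ublock unitrM -!unitmxE.
  by rewrite block_mxKul => /andP[].
rewrite -[g in LHS]submxK dl0 (scalar_mx_block n n 1) !block_mxEh !row_mxKl.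
by rewrite mul_col_mx mul1mx mul0mx.
Qed.

Lemma translate_siegel g : Sp g -> translate g (@siegel R n) = lag_coset (lsubmx g).
Proof. by move=> Sg; rewrite siegelE translate_lag_coset // mulmx_lsub mulmx1. Qed.

(** * Bases adapted to a flag *)

Lemma adapted_basis (F : seq {vspace 'cV[R]_n}) (X : seq 'cV[R]_n) :
    free X -> path (fun U W => (U <= W)%VS && (U != W)) <<X>>%VS F ->
  exists Y, [/\ free (X ++ Y), <<X ++ Y>>%VS = fullv
    & forall U, U \in F -> exists d, U = <<take d (X ++ Y)>>%VS].
Proof.
have ext (Z : seq 'cV[R]_n) U : free Z -> (<<Z>> <= U)%VS ->
    exists Y, free (Z ++ Y) /\ <<Z ++ Y>>%VS = U.
  move=> fZ ZU; exists (vbasis (U :\: <<Z>>)).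
  have /andP[/eqP spn fb] := vbasisP (U :\: <<Z>>).
  rewrite cat_free fZ fb span_cat spn; split.
    by apply/directv_addP; rewrite capvC capv_diff.
  by rewrite addvC addv_diff; apply/addv_idPl.
elim: F X => [|U F IH] X fX /=.
  have [Y [fY sY]] := ext X fullv fX (subvf _).
  by move=> _; exists Y; split.
case/andP=> /andP[XU _] pF; have [Y [fY sY]] := ext X U fX XU.
rewrite -sY in pF; have [Z [fZ sZ hZ]] := IH _ fY pF.
exists (Y ++ Z); rewrite catA; split=> // W; rewrite inE => /predU1P[->|/hZ //].
by exists (size (X ++ Y)); rewrite take_size_cat.
Qed.

(** The flag becomes a chain of coordinate subspaces spanned by initial segments
    in the basis h, and upper triangular matrices preserve those. *)
Lemma adapted_frame (F : seq {vspace 'cV[R]_n}) : is_flag F ->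
  exists2 h : 'M[R]_n, h \in unitmx & forall p, p \in unitmx ->
    is_trig_mx p^T -> forall U, U \in F -> mximg (h *m p *m invmx h) U = U.
Proof.
case: F => [_|U F]; first by exists 1%:M; rewrite ?unitmx1.
rewrite /is_flag /= => sF.
have [X0 [f0 s0]] : exists X0, free X0 /\ <<X0>>%VS = U.
  exists (vbasis U); have /andP[/eqP spn fb] := vbasisP U; by split.
have pF : path (fun U W => (U <= W)%VS && (U != W)) <<X0>>%VS F by rewrite s0.
have [Y [fX sX hX]] := adapted_basis f0 pF.
have {hX} : forall W, W \in U :: F -> exists d, W = <<take d (X0 ++ Y)>>%VS.
  move=> W; rewrite inE => /predU1P[->|/hX //].
  by exists (size X0); rewrite take_size_cat.
move: (X0 ++ Y) fX sX => X fX sX hX.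
have szX : size X = n.
  by rewrite -(eqP fX) sX dimvf /dim /= muln1.
pose h : 'M[R]_n := \matrix_(i, j) X`_j i 0.
have hE (v : 'cV[R]_n) : h *m v = \sum_j v j 0 *: X`_j.
  apply/colP=> i; rewrite !mxE summxE; apply: eq_bigr => j _.
  by rewrite !mxE mulrC.
have uh : h \in unitmx.
  have szX' : size X == n by rewrite szX.
  pose Z : 'M[R]_n := \matrix_(k, i) coord (Tuple szX') k (delta_mx i 0).
  suff /mulmx1_unit[] : h *m Z = 1%:M by [].
  apply/trmx_inj/row_matrixP=> i; rewrite -!tr_col; congr (_^T).
  rewrite !colE mul1mx -mulmxA -colE hE.
  have /coord_span {1}-> : (delta_mx i 0 : 'cV[R]_n) \in <<Tuple szX'>>%VS.
    by rewrite sX memvf.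
  by apply: eq_bigr => k _; rewrite !mxE.
exists h => // p up tp W WF; have [d ->] := hX W WF.
apply: mximg_stable => [|u uW]; first by rewrite !unitmx_mul uh up unitmx_inv.
rewrite -[_ *m u](lfunE (mulmx (h *m p *m invmx h))).
have := memv_img (linfun (mulmx (h *m p *m invmx h))) uW.
apply/subvP; rewrite limg_span; apply/span_subvP=> w /mapP[x /(nthP 0)[j]].
rewrite size_take_min ltn_min => /andP[lt_jd lt_jX].
rewrite nth_take // => <- ->; rewrite lfunE /=.
have lt_jn : (j < n)%N by rewrite -szX.
have -> : X`_j = h *m delta_mx (Ordinal lt_jn) 0.
  by rewrite -colE; apply/colP=> i; rewrite !mxE.
rewrite -!mulmxA mulKmx // -colE hE; apply: rpred_sum => k _.
have [le_kj|lt_jk] := leqP k j.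
  apply/rpredZ/memv_span; rewrite -(nth_take 0 (leq_ltn_trans le_kj lt_jd)).
  apply: mem_nth; rewrite size_take_min ltn_min (leq_ltn_trans le_kj lt_jd).
  by rewrite szX ltn_ord.
have := is_trig_mxP tp (Ordinal lt_jn) k lt_jk.
by rewrite !mxE => ->; rewrite scale0r mem0v.
Qed.
End Cosets.

(** * Finiteness of the set of orbits *)

Section Orbits.
Variables (R : realType) (n : nat).
Implicit Types (a c p q r A C : 'M[R]_n) (g h l : 'M[R]_(n + n)).

(** Sign matrices are encoded by matrices over the finite type 'I_3, so that
    they form a finite type. *)
Definition sign_pattern (s : 'M['I_3]_n) : 'M[R]_n :=
  map_mx (fun k : 'I_3 => [:: -1; 0; 1]`_k) s.

Lemma sign_mx_pattern (N : 'M[R]_n) : sign_mx N -> exists s, N = sign_pattern s.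
Proof.
move=> sN; exists (\matrix_(i, j) inord (index (N i j) [:: -1; 0; 1])).
apply/matrixP=> i j; rewrite !mxE inordK ?nth_index //.
by have := sN i j; rewrite -index_mem.
Qed.

Lemma Sp_normal_form g : Sp g -> exists S s p r,
  [/\ p \in unitmx, is_trig_mx p^T, r \in unitmx
    & lsubmx g = levi_embed p *m lag_model S (sign_pattern s) *m r].
Proof.
move=> Sg; have [ug _] := Sg.
have gE : lsubmx g = col_mx (ulsubmx g) (dlsubmx g).
  by rewrite -[g in LHS]submxK block_mxEh row_mxKl.
have gK : usubmx (invmx g) *m col_mx (ulsubmx g) (dlsubmx g) = 1%:M.
  rewrite -gE mulmx_lsub mul_usub_mx mulVmx // (scalar_mx_block n n 1).
  by rewrite block_mxEv col_mxKu row_mxKl.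
have [S [N [p [r [up tp ur sN E]]]]] := lagrangian_normal_form (Sp_lagrangian Sg) gK.
have [s Ns] := sign_mx_pattern sN.
by exists S, s, p, r; split; rewrite // -Ns -E.
Qed.

Lemma translate_flag_stabilizer (F : seq {vspace 'cV[R]_n}) q :
    q \in unitmx -> (forall U, U \in F -> mximg q U = U) ->
  let Q := [set levi_embed a | a in flag_stabilizer F] in
  translate (levi_embed q) Q = Q.
Proof.
move=> uq qF Q; have stable b : b \in unitmx -> (forall U, U \in F -> mximg b U = U) ->
    forall x, Q x -> Q (levi_embed b *m x).
  move=> ub bF _ [a [ua aF] <-]; exists (b *m a); last by rewrite levi_embedM.
  split; first by rewrite /GLset /= unitmx_mul ub.
  by move=> U UF; rewrite mximgM aF // bF.
apply: translate_stable; first exact: levi_embed_unit.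
  exact: stable.
have uq' : invmx q \in unitmx by rewrite unitmx_inv.
have -> : invmx (levi_embed q) = levi_embed (invmx q).
  apply: (can_inj (mulKmx (levi_embed_unit uq))).
  by rewrite mulmxV ?levi_embed_unit // -levi_embedM // mulmxV // levi_embed1.
apply: stable => // U UF.
by rewrite -{1}(qF U UF) -mximgM mulVmx // mximg1.
Qed.

Lemma diag_orbit_levi a (x : set 'M[R]_(n + n) * set 'M[R]_(n + n)) :
  a \in unitmx ->
  diag_orbit (@levi R n) (diag_act (levi_embed a) x) = diag_orbit (@levi R n) x.
Proof.
move=> ua; apply/seteqP; split=> _ [_ [b ub <-] <-].
  exists (levi_embed (b *m a)).
    by exists (b *m a); rewrite // /GLset /= unitmx_mul ub.
  by rewrite levi_embedM // /diag_act !translateM.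
have ua' : invmx a \in unitmx by rewrite unitmx_inv.
exists (levi_embed (b *m invmx a)).
  by exists (b *m invmx a); rewrite // /GLset /= unitmx_mul ub.
by rewrite /diag_act -!translateM -levi_embedM ?mulmxKV // unitmx_mul ub.
Qed.
End Orbits.

Theorem corollary2p9 (R : realType) (n : nat) (hn : (1 <= n)%N)
    (Q : set 'M[R]_(n + n)) (hQ : parabolic_levi Q) :
  finite_set [set diag_orbit (@levi R n) x | x in double_flag Q].
Proof.
have [_ [F flagF ->] QE] := hQ.
have [h uh hF] := adapted_frame flagF.
pose base (k : {set 'I_n} * 'M['I_3]_n) :=
  (lag_coset (levi_embed h *m lag_model k.1 (sign_pattern R k.2)), Q).
apply: (@sub_finite_set _ _ [set diag_orbit (@levi R n) (base k) | k in setT]);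
  last exact/finite_image/finite_finset.
move=> _ [[_ _] [/= [g Sg <-] [_ [a ua <-] <-]] <-].
have uah : a *m h \in unitmx by rewrite unitmx_mul ua.
have uah' : invmx (a *m h) \in unitmx by rewrite unitmx_inv.
have [S [s [p [r [up tp ur E]]]]] := Sp_normal_form (SpM (levi_embed_Sp uah') Sg).
have {E} gE : lsubmx g =
    levi_embed (a *m h) *m (levi_embed p *m lag_model S (sign_pattern R s)) *m r.
  by rewrite -mulmxA -E -mulmx_lsub mulmxA -levi_embedM // mulmxV // levi_embed1 mul1mx.
(* The base change p, read in the frame h, is an element q of the parabolic,
   so it moves the Lagrangian to its model without changing the coset of Q. *)
pose q := h *m p *m invmx h.
have uq : q \in unitmx by rewrite !unitmx_mul uh up unitmx_inv.
have uaq : a *m q \in unitmx by rewrite unitmx_mul ua.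
exists (S, s) => //; rewrite -(diag_orbit_levi _ uaq); congr diag_orbit.
congr pair => /=.
  rewrite translate_siegel // gE lag_cosetMr // translate_lag_coset;
    last exact: levi_embed_Sp.
  congr lag_coset; rewrite !(mulmxA (levi_embed _)) -!levi_embedM //.
  by rewrite /q -!mulmxA mulVmx // mulmx1.
by rewrite levi_embedM // translateM QE translate_flag_stabilizer // => U UF; apply: hF.
Qed.
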